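(* Let $k\ge 1$ and $m\ge 2$ be integers, let $\sigma_1,\ldots,\sigma_k$ be permutations of $\{1,\ldots,m\}$, and let $\epsilon_{ij}\in\{-1,0,1\}$ for $1\le i\le k$, $1\le j\le m$, be such that the equation system $$x_{\sigma_i(1)}^{\epsilon_{i\sigma_i(1)}}\,x_{\sigma_i(2)}^{\epsilon_{i\sigma_i(2)}}\cdots x_{\sigma_i(m)}^{\epsilon_{i\sigma_i(m)}}=1,\qquad i=1,\ldots,k,$$ is strongly graph-representable. There is a function $\delta'=\delta'(\delta)$ of $\delta>0$, depending only on $\delta$ and the system, with $\delta'(\delta)\to0$ as $\delta\to0^+$, such that the following holds for every $\delta>0$. Let $G$ be a finite group (not necessarily abelian, written multiplicatively) of order $N$ and let $A_1,\ldots,A_m$ be subsets of $G$. If the system has less than $\delta N^{m-k}$ solutions $(x_1,\ldots,x_m)$ in $G^m$ with $x_i\in A_i$ for all $i$, then there are subsets $A'_i\subseteq A_i$ with $|A_i\setminus A'_i|\le\delta' N$ for all $i=1,\ldots,m$ such that there is no solution of the system with $x_i\in A'_i$ for all $i$.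
   Context: Strong graph-representability. The system is strongly graph-representable if there is a directed graph $H$ with $m$ arcs colored by $1,\ldots,m$ (one arc for each color, the arc colored $j$ corresponding to the variable $x_j$) and a spanning tree $T$ of $H$ such that the fundamental cycles of $H$ with respect to $T$ are the $k$ cycles $C_1,\ldots,C_k$, one for each equation, defined as follows. $C_i$ is the cycle traversing the arcs of $H$ in the order $e_{i1}e_{i2}\ldots e_{im}$, where some of the $e_{ij}$ may be ''empty'' (i.e. they do not define an arc of $H$ and are skipped): if $\epsilon_{i\sigma_i(j)}=+1$, then $e_{ij}$ is the arc colored $\sigma_i(j)$ traversed in its direction; if $\epsilon_{i\sigma_i(j)}=-1$, then $e_{ij}$ is the arc colored $\sigma_i(j)$ traversed in the opposite direction; and if $\epsilon_{i\sigma_i(j)}=0$, then $e_{ij}$ is empty. Here spanning trees and cycles are taken in the underlying undirected graph of $H$; the fundamental cycles with respect to $T$ are the cycles formed by one arc not in $T$ together with the path in $T$ joining its end-vertices, one cycle for each arc not in $T$. Asymptotics. The function $\delta'$ does not depend on $N$, on the structure of $G$, or on the sets $A_i$. This is the precise meaning of the formulation ''if the system has $o(N^{m-k})$ solutions with $x_i\in A_i$, then there are $A_i'\subseteq A_i$ with $|A_i\setminus A_i'|=o(N)$ such that there is no solution with $x_i\in A_i'$''. *)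

(* Defs.v *)
From mathcomp Require Import all_boot all_order all_fingroup all_algebra.

Set Implicit Arguments.
Unset Strict Implicit.
Unset Printing Implicit Defensive.

(* Finite directed multigraphs (loops and parallel arcs allowed), with arcs
   indexed by [A]. *)
Record digraph (A : finType) := Digraph {
  vertex : finType;
  arc_src : A -> vertex;
  arc_tgt : A -> vertex
}.

Section UndirectedWalks.
Variables (A : finType) (H : digraph A).

(* A step [(b, a)] traverses [a] in its direction if [b] is [true], and in the
   opposite direction otherwise; walks of the underlying undirected graph are
   sequences of steps. *)
Definition step : Type := (bool * A)%type.

Definition step_src (s : step) : vertex H :=
  if s.1 then arc_src H s.2 else arc_tgt H s.2.

Definition step_tgt (s : step) : vertex H :=
  if s.1 then arc_tgt H s.2 else arc_src H s.2.

Fixpoint is_walk (u v : vertex H) (p : seq step) : bool :=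
  if p is s :: p' then (step_src s == u) && is_walk (step_tgt s) v p'
  else u == v.

Definition is_path (u v : vertex H) (p : seq step) : bool :=
  is_walk u v p && uniq (u :: map step_tgt p).

(* Distinctness of the arcs excludes going back and forth along one arc, which
   distinctness of the vertices does not do in length 2. A loop is a cycle of
   length 1, and two parallel arcs form a cycle of length 2. *)
Definition is_cycle (c : seq step) : bool :=
  [&& c != [::], path.cycle (fun s t => step_tgt s == step_src t) c,
      uniq (map step_src c) & uniq (map snd c)].

Definition arcs_of (p : seq step) : {set A} := [set a in map snd p].

Definition spanning_tree (T : {set A}) : Prop :=
  (forall u v, exists p, is_walk u v p /\ arcs_of p \subset T) /\
  (forall c, is_cycle c -> ~~ (arcs_of c \subset T)).

(* [c] may start anywhere on the fundamental cycle of [a], and may traverse it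
   in either direction. *)
Definition fundamental_cycle (T : {set A}) (a : A) (c : seq step) : Prop :=
  [/\ a \notin T, is_cycle c &
      exists p, [/\ is_path (arc_src H a) (arc_tgt H a) p,
                    arcs_of p \subset T & arcs_of c = a |: arcs_of p]].

End UndirectedWalks.

Section Systems.
Variables (k m : nat) (sigma : 'I_k -> 'S_m) (eps : 'I_k -> 'I_m -> int).

Definition eq_steps (i : 'I_k) : seq (step 'I_m) :=
  [seq (eps i (sigma i j) == 1%R, sigma i j)
     | j <- enum 'I_m & eps i (sigma i j) != 0%R].

(* [f i] is the arc outside [T] that determines the [i]-th cycle. *)
Definition strongly_graph_representable : Prop :=
  exists (H : digraph 'I_m) (T : {set 'I_m}) (f : 'I_k -> 'I_m),
    [/\ spanning_tree H T,
        injective f,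
        [set f i | i : 'I_k] = ~: T &
        forall i, fundamental_cycle H T (f i) (eq_steps i)].

Definition expgz (gT : finGroupType) (x : gT) (z : int) : gT :=
  match z with
  | Posz n => (x ^+ n)%g
  | Negz n => (x ^- n.+1)%g
  end.

Definition is_solution (gT : finGroupType) (x : {ffun 'I_m -> gT}) : bool :=
  [forall i : 'I_k,
     (\prod_(j < m) expgz (x (sigma i j)) (eps i (sigma i j)))%g == 1%g].

Definition solutions_in (gT : finGroupType) (A : 'I_m -> {set gT}) :
    {set {ffun 'I_m -> gT}} :=
  [set x | is_solution x & [forall j, x j \in A j]].

End Systems.

(* Main.v *)
Require Import Defs.
From mathcomp Require Import all_boot all_order all_fingroup all_algebra.
From mathcomp Require Import all_classical all_reals all_analysis.
From mathcomp Require Import lra ring.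

(** A solution of the system is a family of potential differences on the
    digraph [H]: values [x a] on the arcs come from a potential [g] on the
    vertices, with [g (arc_tgt a) = g (arc_src a) * x a], exactly when they
    solve the equations.  Any values on the tree arcs integrate to a potential
    ([acyclic_potential]), and the equation of a fundamental cycle says that the
    potential also fits the arc outside the tree ([cycle_closes]); conversely
    potential differences multiply to 1 around every cycle ([cycle_prod]).
    These are combined in [solution_potential].

    Fix the sets [A a] and, for adjacent vertices [u], [v] of [H], join [y] to
    [z] when [y^-1 * z] is admissible for all arcs between [u] and [v]
    ([cayley]).  The maps from the vertices of [H] to the group that respect
    all these relations are the potentials of the solutions in [A] (as soon as
    there is a solution, which forces 1 to be admissible on loops), and a
    potential is determined by its solution and by its value at one vertex.
    So few solutions give few such maps.  The graph removal lemma
    ([graph_removal]) then destroys all of them by deleting few pairs [(y, z)].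
    A group element is discarded from [A a] when a fixed proportion of the
    pairs [(y, y * b)] that it labels has been deleted; by double counting few
    elements are discarded ([card_popular]).  If a solution survived, its
    potential [g] would have [#|gT|] left translates [t * g], all with the same
    potential differences.  Since each of these differences lost only a small
    proportion of its pairs, some translate would use no deleted pair, which is
    impossible ([discard_consistent]).

    The removal lemma rests on a form of Szemeredi's regularity lemma
    ([regularity]), proved by energy increment, for one colouring of the ground
    set that is simultaneously regular for finitely many relations.  Only a
    lower bound on the number of edges inside rectangles is required, since
    counting ([counting_lemma]) is only used to find many copies.  Pairs in
    irregular, sparse or tiny cells are deleted; a map that avoids the deleted
    pairs selects cells in which a positive proportion of all maps respect
    the relations.

    Finally, the modulus [delta'] is obtained by taking, for each [delta], an
    infimum of the admissible bounds ([modulus_exists]). *)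

Set Implicit Arguments.
Unset Strict Implicit.
Unset Printing Implicit Defensive.

Import Order.TTheory GRing.Theory Num.Theory.
Local Open Scope ring_scope.

(** * Conditional averages and energy *)

Section ConditionalAverage.
Variables (R : realFieldType) (Z K : finType) (k : Z -> K).

Definition cell_size (z : Z) : R := #|[pred w | k w == k z]|%:R.

Definition cond_avg (f : Z -> R) (z : Z) : R :=
  (\sum_(w | k w == k z) f w) / cell_size z.

Definition cell_constant (T : Type) (g : Z -> T) : Prop :=
  forall z w, k z = k w -> g z = g w.

Lemma cell_size_gt0 z : 0 < cell_size z.
Proof. by rewrite ltr0n; apply/card_gt0P; exists z; rewrite inE. Qed.

Lemma cell_size_constant : cell_constant cell_size.
Proof. by move=> z w e; rewrite /cell_size e. Qed.

Lemma cond_avg_constant f : cell_constant (cond_avg f).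
Proof. by move=> z w e; rewrite /cond_avg /cell_size e. Qed.

Lemma cond_avg_ge0 f z : (forall w, 0 <= f w) -> 0 <= cond_avg f z.
Proof. by move=> f0; rewrite divr_ge0 ?sumr_ge0 // ltW ?cell_size_gt0. Qed.

Lemma cond_avg_le1 f z : (forall w, f w <= 1) -> cond_avg f z <= 1.
Proof.
move=> f1; rewrite ler_pdivrMr ?cell_size_gt0 // mul1r /cell_size -sum1_card.
by rewrite natr_sum ler_sum.
Qed.

(** Averaging over cells is a self-adjoint projection whose image is the space
    of cell-constant functions. *)
Lemma sum_cond_avgM f g : cell_constant g ->
  \sum_z cond_avg f z * g z = \sum_z f z * g z.
Proof.
move=> gC; rewrite /cond_avg.
under eq_bigr do rewrite -mulrA mulr_suml big_mkcond.
rewrite exchange_big /=; apply: eq_bigr => w _.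
rewrite -big_mkcond /=.
rewrite (eq_bigr (fun=> f w * g w / cell_size w)) => [|z /eqP e]; last first.
  by rewrite (gC w z e) (cell_size_constant e) mulrA mulrAC.
rewrite (eq_bigl [pred z | k z == k w]) => [|z]; last by rewrite /= eq_sym.
rewrite sumr_const -[RHS]mulr1 -[_ *+ _]mulr_natr -mulrA mulVf //.
by rewrite gt_eqF ?cell_size_gt0.
Qed.

Lemma sum_cond_avg f : \sum_z cond_avg f z = \sum_z f z.
Proof.
have := @sum_cond_avgM f (fun=> 1) (fun _ _ _ => erefl).
by under eq_bigr do rewrite mulr1; under [in RHS]eq_bigr do rewrite mulr1.
Qed.

End ConditionalAverage.

Arguments cell_constant {Z K} k {T} g.

(** Pythagoras: the average over the coarser cells is the orthogonal projection
    of the average over the finer ones. *)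
Lemma energy_refine (R : realFieldType) (Z K K' : finType)
    (k : Z -> K) (k' : Z -> K') (f : Z -> R) :
  cell_constant k' k ->
  \sum_z cond_avg k' f z ^+ 2 =
  \sum_z cond_avg k f z ^+ 2 + \sum_z (cond_avg k' f z - cond_avg k f z) ^+ 2.
Proof.
move=> k'k.
have e1 : \sum_z cond_avg k' f z * cond_avg k f z = \sum_z cond_avg k f z ^+ 2.
  rewrite sum_cond_avgM => [|z w /k'k]; last exact: cond_avg_constant.
  by rewrite -(@sum_cond_avgM _ _ _ k) //; exact: cond_avg_constant.
rewrite -big_split /=.
rewrite [RHS](eq_bigr (fun z => cond_avg k' f z ^+ 2 +
   (cond_avg k f z ^+ 2 - cond_avg k' f z * cond_avg k f z) *+ 2)) => [|z _].
  by rewrite big_split /= sumrMnl sumrB e1 subrr mul0rn addr0.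
by rewrite mulr2n; ring.
Qed.

(** * The regularity lemma *)

Section Regularity.
Variable R : realFieldType.

Definition pair_color (G C : finType) (c : G -> C) (z : G * G) : C * C :=
  (c z.1, c z.2).

Section Colouring.
Variables (G C : finType) (c : G -> C) (f : G * G -> R) (eps : R).
Let k := pair_color c.

(** How many edges the part of the rectangle [X * Y] in the cell of [z] lacks,
    compared with the density of the cell. *)
Definition deficit (X Y : {set G}) (z : G * G) : R :=
  \sum_(w | [&& k w == k z, w.1 \in X & w.2 \in Y]) (cond_avg k f w - f w).

Definition irregular (z : G * G) : bool :=
  [exists X : {set G}, exists Y : {set G},
     eps * cell_size R k z < deficit X Y z].

Lemma irregular_constant : cell_constant k irregular.
Proof.
move=> z w e; apply: eq_existsb => X; apply: eq_existsb => Y.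
by rewrite (cell_size_constant R e) /deficit e.
Qed.

Definition regular (eps' : R) : bool :=
  #|[pred z | irregular z]|%:R <= eps' * #|G|%:R ^+ 2.

(** One rectangle per cell, so that the colouring can be refined by all these
    rectangles at once. *)
Lemma irregular_witness :
  exists W : C * C -> {set G} * {set G}, forall z, irregular z ->
    eps * cell_size R k z < deficit (W (k z)).1 (W (k z)).2 z.
Proof.
have [q|W hW] := @fin_all_exists _ _ (fun q (XY : {set G} * {set G}) =>
    forall z, k z = q -> irregular z ->
    eps * cell_size R k z < deficit XY.1 XY.2 z).
  have [/existsP[z0 /andP[/eqP zq /existsP[X /existsP[Y XY]]]]|no] :=
    boolP [exists z, (k z == q) && irregular z].
    exists (X, Y) => z zq' _; have e : k z = k z0 by rewrite zq zq'.
    by rewrite (cell_size_constant R e) /deficit e.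
  exists (finset.set0, finset.set0) => z zq iz.
  by case/existsP: no; exists z; rewrite zq eqxx.
by exists W => z; exact: hW.
Qed.

(** The second component of the new colour of [x] tells in which rectangles [x]
    is a possible row, the third in which it is a possible column.  On the union
    [tau] of the witnessing rectangles the new averages are on the whole lower
    than the old ones by [eps] per point of each irregular cell, and this
    correlation bounds the energy of the difference from below. *)
Lemma energy_increment (eps' : R) : 0 < eps -> ~~ regular eps' ->
  exists c' : G -> C * ({set C} * {set C}),
    cell_constant (pair_color c') k /\
    \sum_z cond_avg k f z ^+ 2 + eps ^+ 2 * (eps' * #|G|%:R ^+ 2)
      <= \sum_z cond_avg (pair_color c') f z ^+ 2.
Proof.
move=> eps0; rewrite -ltNge => irr; have [W hW] := irregular_witness.
pose c' x := (c x, ([set B | x \in (W (c x, B)).1], [set A | x \in (W (A, c x)).2])).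
have k'k : cell_constant (pair_color c') k.
  by move=> z w [e1 _ _ e2 _ _]; rewrite /k /pair_color e1 e2.
exists c'; split=> //; rewrite (energy_refine f k'k) lerD2l.
pose tau w := [&& irregular w, w.1 \in (W (k w)).1 & w.2 \in (W (k w)).2].
have tauC : cell_constant (pair_color c') tau.
  move=> z w e; rewrite /tau (irregular_constant (k'k _ _ e)) (k'k _ _ e).
  case: e => e11 /setP/(_ (c w.2)) + _ e21 _ /setP/(_ (c w.1)).
  by rewrite !inE /k /pair_color e11 e21 => -> ->.
pose u z := cond_avg (pair_color c') f z - cond_avg k f z.
under eq_bigr do rewrite -/(u _).
pose h w := (cond_avg k f w - f w) * (tau w)%:R.
have hu : \sum_w h w = - \sum_w u w * (tau w)%:R.
  rewrite -sumrN /u /h.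
  under eq_bigr do rewrite mulrBl.
  under [in RHS]eq_bigr do rewrite -mulNr opprB mulrBl.
  rewrite !sumrB; congr (_ - _); rewrite (@sum_cond_avgM _ _ _ _ f) //.
  by move=> z w /tauC ->.
have hI : eps * #|[pred z | irregular z]|%:R <= \sum_w h w.
  rewrite -(sum_cond_avg k) -sum1_card natr_sum mulr_sumr big_mkcond /=.
  apply: ler_sum => z _; rewrite unfold_in /=.
  have -> : cond_avg k h z = (irregular z)%:R *
     (deficit (W (k z)).1 (W (k z)).2 z / cell_size R k z).
    rewrite /cond_avg mulrA; congr (_ / _).
    rewrite /deficit mulr_sumr /h /tau.
    rewrite [in RHS]big_mkcond [LHS]big_mkcond; apply: eq_bigr => w _ /=.
    case: eqP => //= e; rewrite (irregular_constant e) e.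
    by case: (_ \in _) (_ \in _) (irregular z) => [] [] [];
      rewrite ?mulr0 ?mulr1 ?mul0r ?mul1r.
  case: ifP => [iz|_]; last by rewrite mul0r.
  by rewrite mul1r mulr1 ler_pdivlMr ?cell_size_gt0 // ltW // hW.
have tI : \sum_w (tau w)%:R <= #|[pred z | irregular z]|%:R :> R.
  rewrite -sum1_card natr_sum [leRHS]big_mkcond; apply: ler_sum => w _.
  by rewrite unfold_in /= /tau; case: (irregular w) => //; rewrite lern1 leq_b1.
have {}hu : \sum_w - (u w * (tau w)%:R) = \sum_w h w by rewrite hu sumrN.
(* This is Cauchy-Schwarz, in the pointwise form
   [- 2 * eps * u - eps ^+ 2 <= u ^+ 2]. *)
apply: (@le_trans _ _ (2 * eps * (\sum_w - (u w * (tau w)%:R))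
                        - eps ^+ 2 * \sum_w (tau w)%:R)).
  rewrite hu; nra.
rewrite !mulr_sumr -sumrB; apply: ler_sum => w _.
case: (tau w); last by rewrite /= !mulr0 oppr0 mulr0 addr0 sqr_ge0.
have := sqr_ge0 (u w + eps); rewrite /= !mulr1; lra.
Qed.

End Colouring.
End Regularity.

(** [M] is a tower in [n]: each increment is exponential in the number of
    colours.  The energies of all the relations are added up, so that refining
    for the sake of one relation does no harm to the others. *)
Lemma regular_or_energy (R : realFieldType) (I : finType) (eps eps' : R)
    (n : nat) : 0 < eps ->
  exists M : nat, forall (G : finType) (f : I -> G * G -> R),
  exists (C : finType) (c : G -> C), (#|C| <= M)%N /\
    ((forall i, regular c (f i) eps eps') \/
     n%:R * (eps ^+ 2 * (eps' * #|G|%:R ^+ 2)) <=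
       \sum_i \sum_z cond_avg (pair_color c) (f i) z ^+ 2).
Proof.
move=> eps0; elim: n => [|n [M IH]].
  exists 1%N => G f; exists unit, (fun=> tt); split; first by rewrite card_unit.
  by right; rewrite mul0r; do 2!apply: sumr_ge0 => ? _; exact: sqr_ge0.
exists (maxn M (M * (2 ^ M * 2 ^ M)))%N => G f.
have [C [c [CM [rc|ec]]]] := IH G f.
  by exists C, c; split; [rewrite leq_max CM | left].
have [/forallP rc|] := boolP [forall i, regular c (f i) eps eps'].
  by exists C, c; split; [rewrite leq_max CM | left].
rewrite negb_forall => /existsP[i0 /energy_increment -/(_ eps0)[c' [c'c inc]]].
have card_set (T : finType) : #|{set T}| = (2 ^ #|T|)%N.
  by rewrite -[in RHS]cardsT -card_powerset powersetT cardsT.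
exists _, c'; split.
  by rewrite leq_max !card_prod !card_set !leq_mul ?orbT // leq_exp2l.
right; rewrite -natr1 mulrDl mul1r; apply: (le_trans (lerD ec (lexx _))).
rewrite (bigD1 i0) //= [leRHS](bigD1 i0) //= addrAC lerD //.
apply: ler_sum => i _; rewrite (energy_refine _ c'c) lerDl.
by apply: sumr_ge0 => z _; exact: sqr_ge0.
Qed.

Lemma regularity (R : archiRealFieldType) (I : finType) (eps eps' : R) :
  0 < eps -> 0 < eps' ->
  exists M : nat, forall (G : finType) (f : I -> G * G -> R),
    (forall i z, 0 <= f i z <= 1) ->
  exists (C : finType) (c : G -> C), (#|C| <= M)%N /\
    forall i, regular c (f i) eps eps'.
Proof.
move=> eps0 eps'0; have b0 : 0 < eps ^+ 2 * eps' by rewrite mulr_gt0 ?exprn_gt0.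
pose n := Num.bound (#|I|%:R / (eps ^+ 2 * eps')).
have [M hM] := @regular_or_energy R I eps eps' n eps0.
exists M => G f f01; have [C [c [CM [rc|ec]]]] := hM G f; exists C, c; split=> // i.
have [N0|N0] := posnP #|G|.
  rewrite /regular N0 expr0n mulr0 lern0 -leqn0 (leq_trans (max_card _)) //.
  by rewrite card_prod N0.
have : \sum_i \sum_z cond_avg (pair_color c) (f i) z ^+ 2
    <= #|I|%:R * #|G|%:R ^+ 2.
  have -> : #|I|%:R * #|G|%:R ^+ 2 = \sum_(i : I) \sum_(z : G * G) 1 :> R.
    by rewrite !sumr_const card_prod -mulrnA expr2 -!natrM mulnC.
  apply: ler_sum => j _; apply: ler_sum => z _; rewrite expr_le1 //.
    by apply: cond_avg_le1 => w; case/andP: (f01 j w).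
  by apply: cond_avg_ge0 => w; case/andP: (f01 j w).
move/(le_trans ec); rewrite [eps ^+ 2 * _]mulrA [n%:R * _]mulrA.
rewrite ler_pM2r ?exprn_gt0 ?ltr0n //  -ler_pdivlMr // => nle.
suff : #|I|%:R / (eps ^+ 2 * eps') < n%:R by rewrite ltNge nle.
by apply: archi_boundP; rewrite divr_ge0 // ltW.
Qed.

(** * Counting maps into regular cells *)

Section Resampling.
Variables (V G : finType) (u v : V).
Hypothesis uv : u != v.

Definition resample (g : {ffun V -> G}) (z : G * G) : {ffun V -> G} :=
  [ffun w => if w == u then z.1 else if w == v then z.2 else g w].

Lemma resample_u g z : resample g z u = z.1.
Proof. by rewrite ffunE eqxx. Qed.

Lemma resample_v g z : resample g z v = z.2.
Proof. by rewrite ffunE eq_sym (negbTE uv) eqxx. Qed.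

(** Exchanging the pair [(g u, g v)] with the fresh pair [z] is an involution. *)
Lemma sum_resample (R : pzRingType) (F : {ffun V -> G} -> R) :
  \sum_g \sum_z F (resample g z) = (#|G| ^ 2)%:R * \sum_g F g.
Proof.
pose phi (p : {ffun V -> G} * (G * G)) := (resample p.1 p.2, (p.1 u, p.1 v)).
have phiK : involutive phi.
  case=> g [x y]; rewrite /phi /= resample_u resample_v; congr (_, _).
  apply/ffunP=> w; rewrite !ffunE; case: eqP => [->//|]; case: eqP => [->//|].
  by [].
rewrite pair_bigA /= (reindex_inj (inv_inj phiK)) /=.
under eq_bigr => p _ do rewrite -[resample _ _]/(phi (phi p)).1 phiK.
rewrite -(pair_bigA _ (fun g _ => F g)) /= mulr_sumr; apply: eq_bigr => g _.
by rewrite sumr_const card_prod mulnn mulr_natl.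
Qed.

(** When all coordinates but [u] and [v] are frozen, [Q] becomes the indicator
    of a rectangle, the kind of set against which regularity is tested. *)
Definition rectangular (Q : {ffun V -> G} -> bool) : Prop :=
  forall g, exists X Y : {set G},
    forall z, Q (resample g z) = (z.1 \in X) && (z.2 \in Y).

Lemma rectangular_and Q1 Q2 : rectangular Q1 -> rectangular Q2 ->
  rectangular (fun g => Q1 g && Q2 g).
Proof.
move=> r1 r2 g; have [X1 [Y1 e1]] := r1 g; have [X2 [Y2 e2]] := r2 g.
by exists (X1 :&: X2)%SET, (Y1 :&: Y2)%SET => z; rewrite !inE e1 e2 andbACA.
Qed.

Lemma rectangular_true : rectangular (fun=> true).
Proof. by move=> g; exists [set: G]%SET, [set: G]%SET => z; rewrite !inE. Qed.

(** An edge other than [{u, v}] constrains at most one of the two coordinates. *)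
Lemma rectangular_edge (E : rel G) a b :
  (a, b) != (u, v) -> (a, b) != (v, u) -> a != b ->
  rectangular (fun g => E (g a) (g b)).
Proof.
rewrite !xpair_eqE => n1 n2 ab g.
have [au|au] := eqVneq a u.
  have bv : b != v by move: n1; rewrite au eqxx.
  have bu : b != u by rewrite -au eq_sym.
  exists [set x | E x (g b)]%SET, [set: G]%SET => z.
  by rewrite !inE au resample_u ffunE (negbTE bv) (negbTE bu) andbT.
have [av|av] := eqVneq a v.
  have bu : b != u by move: n2; rewrite av eqxx.
  have bv : b != v by rewrite -av eq_sym.
  exists [set: G]%SET, [set x | E x (g b)]%SET => z.
  by rewrite !inE av resample_v ffunE (negbTE bv) (negbTE bu).
have [bu|bu] := eqVneq b u.
  exists [set x | E (g a) x]%SET, [set: G]%SET => z.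
  by rewrite !inE bu resample_u ffunE (negbTE au) (negbTE av) andbT.
have [bv|bv] := eqVneq b v.
  exists [set: G]%SET, [set x | E (g a) x]%SET => z.
  by rewrite !inE bv resample_v ffunE (negbTE au) (negbTE av).
exists (if E (g a) (g b) then [set: G]%SET else finset.set0), [set: G]%SET => z.
rewrite !ffunE (negbTE au) (negbTE av) (negbTE bu) (negbTE bv).
by case: ifP => _; rewrite !inE.
Qed.

End Resampling.

Section Counting.
Variables (R : realFieldType) (V G : finType) (D : rel V).
Hypothesis D_asym : forall u v, D u v -> ~~ D v u.
Variables (E : V -> V -> rel G) (S : V -> {set G}) (d eps : R).
Hypotheses (d0 : 0 <= d) (d1 : d <= 1) (eps0 : 0 <= eps).

Hypothesis dense : forall u v, D u v -> forall X Y : {set G},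
  \sum_(z | [&& z.1 \in S u, z.2 \in S v, z.1 \in X & z.2 \in Y])
     (d - (E u v z.1 z.2)%:R) <= eps * (#|S u| * #|S v|)%:R.

Definition in_box (g : {ffun V -> G}) : bool := [forall w, g w \in S w].

Definition respects (s : seq (V * V)) (g : {ffun V -> G}) : bool :=
  all (fun p => E p.1 p.2 (g p.1) (g p.2)) s.

Let T s : R := \sum_(g | in_box g) (respects s g)%:R.

Lemma D_neq u v : D u v -> u != v.
Proof. by move=> Duv; apply/eqP => e; move: Duv (D_asym Duv); rewrite -e => ->. Qed.

(** Once all coordinates but [u] and [v] are frozen, the box and the constraints
    in [s] define a rectangle in [S u * S v], to which [dense] applies. *)
Lemma discrepancy u v s : D u v -> (u, v) \notin s ->
  all (fun p => D p.1 p.2) s ->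
  \sum_(g | in_box g) (respects s g)%:R * (d - (E u v (g u) (g v))%:R)
    <= eps * T [::].
Proof.
move=> Duv uvs sD; have uv := D_neq Duv.
have [N0|N0] := posnP #|G|.
  by rewrite /T !big1 ?mulr0 // => g; have := fintype0 (g u) N0.
have rect : rectangular u v (respects s).
  rewrite /respects; elim: s uvs sD => [|[a b] s IH] /=.
    by move=> _ _; exact: rectangular_true.
  rewrite inE negb_or => /andP[n1 uvs] /andP[Dab sD].
  apply: rectangular_and => //; last exact: IH.
  apply: rectangular_edge => //; first by rewrite eq_sym.
    apply: contraTneq Dab => -[-> ->]; exact: D_asym.
  exact: D_neq Dab.
have N20 : 0 < (#|G| ^ 2)%:R :> R by rewrite ltr0n expn_gt0 N0.
rewrite -(ler_pM2l N20) mulrCA /T.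
rewrite big_mkcond [X in _ <= eps * (_ * X)]big_mkcond /=.
rewrite -!(sum_resample uv) mulr_sumr; apply: ler_sum => g _.
have boxE z : in_box (resample u v g z) =
    [forall w, (w == u) || (w == v) || (g w \in S w)] &&
      ((z.1 \in S u) && (z.2 \in S v)).
  apply/forallP/andP => [h|[/forallP h /andP[h1 h2]] w].
    split; last by have := h u; have := h v; rewrite resample_u resample_v // => -> ->.
    by apply/forallP => w; have := h w; rewrite ffunE; case: eqP => //; case: eqP.
  have := h w; rewrite ffunE; case: eqP => [->//|_]; case: eqP => [->//|_].
  by [].
case: [forall w, _] in boxE *; last first.
  by rewrite !big1 ?mulr0 // => z _; rewrite boxE.
have [X [Y XY]] := rect g.
have -> : \sum_z (if in_box (resample u v g z)
          then (respects [::] (resample u v g z))%:R else 0) = (#|S u| * #|S v|)%:R :> R.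
  rewrite -cardsX -sum1_card natr_sum big_mkcond [RHS]big_mkcond /=.
  by apply: eq_bigr => z _; rewrite boxE !inE.
apply: le_trans (dense Duv X Y); rewrite [leRHS]big_mkcond /=.
rewrite le_eqVlt; apply/orP; left; apply/eqP; apply: eq_bigr => z _.
rewrite boxE XY resample_u resample_v //=.
by case: (z.1 \in S u) (z.2 \in S v) (z.1 \in X) (z.2 \in Y) => [] [] [] [];
  rewrite /= ?mul0r ?mul1r.
Qed.

(** Each edge added to [s] multiplies the number of maps by at least [d], up to
    an error [eps] relative to the whole box. *)
Lemma counting_lemma s : all (fun p => D p.1 p.2) s -> uniq s ->
  (d ^+ size s - (size s)%:R * eps) * T [::] <= T s.
Proof.
have T0 : 0 <= T [::] by apply: sumr_ge0.
elim: s => [|[u v] s IH] /=; first by rewrite mul0r subr0 mul1r.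
case/andP=> Duv sD /andP[uvs us].
have := discrepancy Duv uvs sD.
rewrite (_ : \sum_(g | _) _ = d * T s - T ((u, v) :: s)); last first.
  rewrite /T mulr_sumr -sumrB; apply: eq_bigr => g _ /=.
  by case: (E u v _ _); case: (respects s g); rewrite /= ?(mul0r,mul1r,mulr0,mulr1,subr0).
have := ler_wpM2l d0 (IH sD us); set n := size s; set t := T [::].
rewrite exprS -natr1; have n0 : 0 <= n%:R :> R by [].
have := mulr_ge0 (mulr_ge0 (mulr_ge0 n0 eps0) T0) (_ : 0 <= 1 - d).
rewrite subr_ge0 => /(_ d1); rewrite -/t; set dn := d ^+ n; lra.
Qed.

Lemma box_count : T [::] = (\prod_w #|S w|)%:R.
Proof.
rewrite /T big_mkcond /=.
have -> : (\prod_w #|S w|)%N = #|family (fun w => mem (S w))|.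
  by rewrite card_family foldrE big_map big_enum.
rewrite -sum1_card natr_sum [RHS]big_mkcond; apply: eq_bigr => g _.
by rewrite unfold_in.
Qed.

End Counting.

(** * The graph removal lemma *)

Lemma card_natr_sum (R : pzRingType) (T : finType) (P : pred T) :
  #|P|%:R = \sum_x (P x)%:R :> R.
Proof.
rewrite -sum1_card natr_sum big_mkcond; apply: eq_bigr => x _.
by rewrite unfold_in; case: (P x).
Qed.

Lemma card_small_cells (R : realFieldType) (G C : finType) (c : G -> C) (b : R) :
  0 <= b -> #|[pred x | cell_size R c x < b]|%:R <= #|C|%:R * b.
Proof.
move=> b0; rewrite card_natr_sum (partition_big c xpredT) //=.
have -> : #|C|%:R * b = \sum_(q : C) b by rewrite sumr_const mulr_natl.
apply: ler_sum => q _.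
have [/existsP[x /andP[/eqP xq small]]|no] :=
  boolP [exists x, (c x == q) && (cell_size R c x < b)].
  apply: le_trans (ltW small); rewrite /cell_size card_natr_sum big_mkcond /=.
  by apply: ler_sum => y _; rewrite xq; case: (c y == q) => //; rewrite lern1 leq_b1.
rewrite big1 // => x xq; case: ltP => // small.
by case/existsP: no; exists x; rewrite xq.
Qed.

(** Inside a cell of density less than [d], a proportion less than [d] of the
    points satisfies [P]; this is summed over these cells. *)
Lemma card_low_density (R : realFieldType) (Z K : finType) (k : Z -> K)
    (P : pred Z) (d : R) : 0 <= d ->
  #|[pred z | P z && (cond_avg k (fun w => (P w)%:R) z < d)]|%:R <= d * #|Z|%:R.
Proof.
move=> d0; pose f z : R := (P z)%:R; rewrite card_natr_sum /=.
rewrite (eq_bigr (fun z => f z * (cond_avg k f z < d)%R%:R)) => [|z _]; last first.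
  by rewrite /f; case: (P z); case: (_ < d); rewrite ?mulr1 ?mulr0.
rewrite -[leLHS](@sum_cond_avgM _ _ _ k f (fun z => (cond_avg k f z < d)%R%:R));
  last move=> z w e; last first.
  by rewrite (cond_avg_constant f e).
have -> : d * #|Z|%:R = \sum_(z : Z) d by rewrite sumr_const mulr_natr.
apply: ler_sum => z _; case: ltP => [/ltW|_]; by rewrite ?mulr1 ?mulr0.
Qed.

Section Removal.
Variables (R : archiRealFieldType) (V : finType) (D : rel V).
Hypothesis D_asym : forall u v, D u v -> ~~ D v u.

Definition is_hom (G : finType) (E : V -> V -> rel G) (g : {ffun V -> G}) : bool :=
  [forall u, forall v, D u v ==> E u v (g u) (g v)].

Section Cleaning.
Variables (G C : finType) (c : G -> C) (E : V -> V -> rel G) (d eps b : R).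

Let f u v (z : G * G) : R := (E u v z.1 z.2)%:R.

Definition cleaned u v : rel G := fun x y =>
  [&& E u v x y, ~~ irregular c (f u v) eps (x, y),
      d <= cond_avg (pair_color c) (f u v) (x, y),
      b <= cell_size R c x & b <= cell_size R c y].

Lemma card_cleaned eps' u v : 0 <= d -> 0 <= b ->
  regular c (f u v) eps eps' ->
  #|[pred z | E u v z.1 z.2 && ~~ cleaned u v z.1 z.2]|%:R <=
  (eps' + d) * #|G|%:R ^+ 2 + 2 * (#|C|%:R * b) * #|G|%:R.
Proof.
move=> d0 b0 reg.
have low := card_low_density (pair_color c) (fun z => E u v z.1 z.2) d0.
have small := card_small_cells c b0.
rewrite /= card_prod natrM in low.
have small1 : #|[pred z : G * G | cell_size R c z.1 < b]|%:R <= #|C|%:R * b * #|G|%:R.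
  rewrite (_ : #|_| = (#|[pred x | (cell_size R c x < b)%R]| * #|G|)%N).
    by rewrite natrM ler_wpM2r.
  by rewrite -cardX; apply: eq_card => z; rewrite !inE andbT.
have small2 : #|[pred z : G * G | cell_size R c z.2 < b]|%:R <= #|C|%:R * b * #|G|%:R.
  rewrite (_ : #|_| = (#|G| * #|[pred x | (cell_size R c x < b)%R]|)%N).
    by rewrite natrM mulrC ler_wpM2r.
  by rewrite -cardX; apply: eq_card => z; rewrite !inE.
have union : #|[pred z | E u v z.1 z.2 && ~~ cleaned u v z.1 z.2]|%:R <=
    #|[pred z | irregular c (f u v) eps z]|%:R
    + #|[pred z | E u v z.1 z.2 && (cond_avg (pair_color c) (f u v) z < d)]|%:R
    + #|[pred z : G * G | cell_size R c z.1 < b]|%:R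
    + #|[pred z : G * G | cell_size R c z.2 < b]|%:R :> R.
  rewrite !card_natr_sum -!big_split /=; apply: ler_sum => -[x y] _ /=.
  rewrite /cleaned /= -!natrD ler_nat !ltNge.
  case: (E u v x y) => //=; case: (irregular _ _ _ _) => //=; rewrite ?addSn //.
  by do 3!case: (_ <= _).
rewrite /regular in reg; rewrite expr2 in reg *; lra.
Qed.

(** The coordinates of [g0] select cells that are regular, dense and large for
    every pair in [D], and the maps into these cells are counted. A vertex that
    belongs to no pair of [D] is unconstrained, and may range over all of [G]. *)
Lemma cleaned_hom_count (eta : R) (g0 : {ffun V -> G}) :
    0 <= d -> d <= 1 -> 0 <= eps -> 0 <= eta -> eta <= 1 ->
    b = eta * #|G|%:R ->
    let p := #|[pred q : V * V | D q.1 q.2]| in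
    0 <= d ^+ p - p%:R * eps ->
    is_hom cleaned g0 ->
  (d ^+ p - p%:R * eps) * eta ^+ #|V| * #|G|%:R ^+ #|V| <= #|is_hom (G := G) E|%:R.
Proof.
move=> d0 d1 eps0 eta0 eta1 bE p main0 /forallP hom0.
have {}hom0 u v : D u v -> cleaned u v (g0 u) (g0 v).
  by move=> Duv; move/forallP/(_ v): (hom0 u); rewrite Duv.
pose touched v := [exists u, D u v || D v u].
pose S v : {set G} := if touched v then [set w | c w == c (g0 v)]%SET else [set: G]%SET.
have DS u v : D u v -> S u = [set w | c w == c (g0 u)]%SET /\
                       S v = [set w | c w == c (g0 v)]%SET.
  move=> Duv; rewrite /S.
  have -> : touched u by apply/existsP; exists v; rewrite Duv orbT.
  by have -> : touched v by apply/existsP; exists u; rewrite Duv.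
have dense u v : D u v -> forall X Y : {set G},
  \sum_(z | [&& z.1 \in S u, z.2 \in S v, z.1 \in X & z.2 \in Y])
     (d - (E u v z.1 z.2)%:R) <= eps * (#|S u| * #|S v|)%:R.
  move=> Duv X Y; have [-> ->] := DS u v Duv.
  have /and5P[_ reg dens _ _] := hom0 u v Duv.
  have -> : (#|[set w | c w == c (g0 u)]%SET| * #|[set w | c w == c (g0 v)]%SET|)%:R
     = cell_size R (pair_color c) (g0 u, g0 v).
    rewrite /cell_size -cardsX; congr (_%:R); apply: eq_card => z.
    by rewrite !inE /pair_color xpair_eqE.
  have : deficit c (f u v) X Y (g0 u, g0 v) <=
     eps * cell_size R (pair_color c) (g0 u, g0 v).
    rewrite leNgt; apply: contra reg => h.
    by apply/existsP; exists X; apply/existsP; exists Y.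
  apply: le_trans; rewrite /deficit.
  rewrite [leLHS](eq_bigl [pred w |
    [&& pair_color c w == pair_color c (g0 u, g0 v), w.1 \in X & w.2 \in Y]]).
    apply: ler_sum => w /and3P[/eqP e _ _].
    by rewrite (cond_avg_constant _ e) lerD2r.
  by move=> z; rewrite /= !inE /pair_color xpair_eqE -andbA.
pose s := [seq q <- enum {: V * V} | D q.1 q.2].
have sD : all (fun q => D q.1 q.2) s by apply: filter_all.
have us : uniq s by rewrite filter_uniq // enum_uniq.
have size_s : size s = p.
  by rewrite /s /p cardE enumT /enum_mem; congr (size _); apply: eq_filter.
have := @counting_lemma R V G D D_asym E S d eps d0 d1 eps0 dense s sD us.
rewrite box_count size_s => cnt.
apply: (@le_trans _ _ ((d ^+ p - p%:R * eps) * (\prod_w #|S w|)%:R)).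
  rewrite -mulrA ler_wpM2l // -exprMn natr_prod -prodr_const.
  apply: ler_prod => w _; rewrite mulr_ge0 //= /S.
  case: ifP => [/existsP[u /orP[/hom0|/hom0] /and5P[_ _ _]]|_].
  - by rewrite bE /cell_size => _; rewrite cardsE.
  - by rewrite bE /cell_size => + _; rewrite cardsE.
  by rewrite cardsT ler_piMl.
apply: (le_trans cnt); rewrite card_natr_sum big_mkcond.
apply: ler_sum => g _; case: ifP => // _; rewrite ler_nat.
case/boolP: (respects _ _ _) => // /allP h; rewrite lt0b.
apply/forallP => u; apply/forallP => v; apply/implyP => Duv.
by apply: (h (u, v)); rewrite mem_filter Duv mem_enum.
Qed.

End Cleaning.

Theorem graph_removal (theta : R) : 0 < theta ->
  exists delta : R, 0 < delta /\
  forall (G : finType) (E : V -> V -> rel G),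
    #|is_hom E|%:R < delta * #|G|%:R ^+ #|V| ->
  exists E' : V -> V -> rel G,
    [/\ forall u v x y, E' u v x y -> E u v x y,
        forall u v,
          #|[pred z | E u v z.1 z.2 && ~~ E' u v z.1 z.2]|%:R <=
            theta * #|G|%:R ^+ 2 &
        forall g, ~~ is_hom E' g].
Proof.
move=> theta0; pose t := Num.min theta 1.
have t0 : 0 < t by rewrite lt_min theta0 ltr01.
have t1 : t <= 1 by rewrite ge_min lexx orbT.
pose p := #|[pred q : V * V | D q.1 q.2]|.
(* Sparse cells, irregular cells and tiny cells each get a third of the
   budget; [eps] makes the counting error at most half of the main term. *)
pose d := t / 3; have d0 : 0 < d by rewrite /d; lra.
have d1 : d <= 1 by rewrite /d; lra.
have p1 : 0 < 2 * (p%:R + 1) :> R by have := ler0n R p; lra.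
pose eps := d ^+ p / (2 * (p%:R + 1)).
have dp : 0 < d ^+ p by rewrite exprn_gt0.
have eps0 : 0 < eps by rewrite divr_gt0.
have main : d ^+ p / 2 <= d ^+ p - p%:R * eps.
  have -> : d ^+ p - p%:R * eps = d ^+ p / 2 + eps.
    by rewrite /eps; field; rewrite gt_eqF //; have := ler0n R p; lra.
  by rewrite lerDl ltW.
have [M hM] := @regularity R (V * V)%type eps d eps0 d0.
pose eta := t / (6 * (M%:R + 1)).
have M0 := ler0n R M.
have eta0 : 0 < eta by rewrite divr_gt0 //; lra.
have etaM : 2 * (M%:R * eta) <= d.
  rewrite /eta /d mulrA mulrA ler_pdivrMr; last by lra.
  nra.
have eta1 : eta <= 1.
  by rewrite ler_pdivrMr; lra.
exists (d ^+ p / 2 * eta ^+ #|V|); split.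
  by rewrite mulr_gt0 ?exprn_gt0 // divr_gt0.
move=> G E few.
have [|C [c [CM reg]]] := hM G (fun q z => (E q.1 q.2 z.1 z.2)%:R).
  by move=> i z; rewrite ler0n lern1 leq_b1.
exists (cleaned c E d eps (eta * #|G|%:R)); split=> [u v x y|u v|g].
- by case/andP.
- have b0 : 0 <= eta * #|G|%:R by rewrite mulr_ge0 // ltW.
  apply: (le_trans (card_cleaned (ltW d0) b0 (reg (u, v)))).
  apply: (@le_trans _ _ (3 * d * #|G|%:R ^+ 2)); last first.
    rewrite ler_wpM2r ?exprn_ge0 // /d mulrC mulfVK ?pnatr_eq0 //.
    by rewrite ge_min lexx.
  have CM' : #|C|%:R <= M%:R :> R by rewrite ler_nat.
  have : #|C|%:R * eta <= M%:R * eta by rewrite ler_wpM2r // ltW.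
  move=> Ceta; have Ceta2 : 2 * (#|C|%:R * eta) <= d by lra.
  have := ler_wpM2r (exprn_ge0 2 (ler0n R #|G|)) Ceta2.
  rewrite (_ : 2 * (#|C|%:R * (eta * _)) * _ = 2 * (#|C|%:R * eta) * #|G|%:R ^+ 2).
    by move: (_ ^+ 2) => N2; lra.
  by ring.
apply/negP => hom; move: few; rewrite ltNge => /negP; apply.
have main0 : 0 <= d ^+ p - p%:R * eps by apply: le_trans main; rewrite divr_ge0 // ltW.
have := cleaned_hom_count (ltW d0) d1 (ltW eps0) (ltW eta0) eta1 erefl main0 hom.
apply: le_trans.
by rewrite ler_wpM2r ?exprn_ge0 // ler_wpM2r ?exprn_ge0 // ltW.
Qed.

End Removal.

(** * Walks, forests and potentials *)

Section Walks.
Variables (A : finType) (H : digraph A).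
Implicit Types (T : {set A}) (u v : vertex H) (p c : seq (step A)) (s : step A).

Lemma arcs_of_subset T p : (arcs_of p \subset T) = all (fun s => s.2 \in T) p.
Proof.
apply/fintype.subsetP/allP => [h s sp|h a].
  by apply: h; rewrite inE map_f.
by rewrite inE => /mapP[s sp ->]; exact: h.
Qed.

(** Both sides list all the vertices of the walk in order. *)
Lemma walk_vertices u v p : is_walk u v p ->
  rcons (map (step_src H) p) v = u :: map (step_tgt H) p.
Proof.
elim: p u => [|s p IH] u /=; first by move/eqP->.
by case/andP=> /eqP <- /IH ->.
Qed.

Lemma walk_cycle s c :
  path.cycle (fun s t => step_tgt H s == step_src H t) (s :: c) =
  is_walk (step_tgt H s) (step_src H s) c.
Proof.
rewrite /=; move: {1 3}s => r.
elim: c r => [|t c IH] r /=; first by rewrite andbT.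
by rewrite eq_sym IH.
Qed.

Lemma uniq_walk_arcs u v p : is_walk u v p ->
  uniq (u :: map (step_tgt H) p) -> uniq (map snd p).
Proof.
elim: p u => [|s p IH] u //= /andP[/eqP su sp] /andP[us ups].
rewrite (IH _ sp ups) andbT; apply: contra us => /mapP[t tp st].
have sub w : w \in map (step_src H) p -> w \in step_tgt H s :: map (step_tgt H) p.
  by rewrite -(walk_vertices sp) mem_rcons inE => ->; rewrite orbT.
have := sub _ (map_f (step_src H) tp).
have : step_tgt H t \in step_tgt H s :: map (step_tgt H) p.
  by rewrite inE map_f ?orbT.
by rewrite -su /step_src /step_tgt -st; case: s.1; case: t.1.
Qed.

Section Linked.
Variable T : {set A}.

Definition linked u v : bool :=
  [exists s : step A, [&& s.2 \in T, step_src H s == u & step_tgt H s == v]].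

Lemma linked_path u (p : seq (vertex H)) : path linked u p ->
  exists q, [/\ is_walk u (last u p) q, map (step_tgt H) q = p
             & all (fun s => s.2 \in T) q].
Proof.
elim: p u => [|v p IH] u /=; first by exists [::]; split=> /=.
case/andP=> /existsP[s /and3P[sT /eqP su /eqP sv]] /IH[q [qw qp qT]].
by exists (s :: q); rewrite /= su sv eqxx qp sT qw qT.
Qed.

End Linked.

Definition acyclic T : Prop := forall c, is_cycle H c -> ~~ (arcs_of c \subset T).

(** A walk in the rest of [T] from the head to the tail of [a] could be shortened
    to a path, which [a] would close to a cycle. *)
Lemma acyclic_bridge T a : acyclic T -> a \in T ->
  ~~ connect (linked (T :\ a)) (arc_tgt H a) (arc_src H a).
Proof.
move=> acT aT; apply/negP => /connectP[p0 p0p p0a].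
case: (shortenP p0p) p0a => p pp up _ pa.
have [q [qw qp qT]] := linked_path pp.
have qT' : all (fun s => s.2 \in T) q.
  by apply: sub_all qT => s; rewrite inE => /andP[].
have cyc : is_cycle H ((true, a) :: q).
  have qw' : is_walk (arc_tgt H a) (arc_src H a) q by rewrite pa.
  apply/and4P; split=> //; first by rewrite walk_cycle.
    rewrite /= -rcons_uniq.
    by rewrite (walk_vertices qw') qp.
  rewrite /= (uniq_walk_arcs qw) ?qp // andbT.
  by apply/negP => /mapP[s /(allP qT) + /= e]; rewrite -e !inE eqxx.
by have := acT _ cyc; rewrite arcs_of_subset /= aT qT'.
Qed.

Lemma acyclic_sub T T' : T' \subset T -> acyclic T -> acyclic T'.
Proof. by move=> sT acT c /acT; apply: contra => /fintype.subset_trans; apply. Qed.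

End Walks.

Section Potentials.
Variables (A : finType) (H : digraph A) (gT : finGroupType).
Implicit Types (T : {set A}) (x : A -> gT) (g : vertex H -> gT).

Definition potential T x g : Prop :=
  forall a, a \in T -> g (arc_tgt H a) = (g (arc_src H a) * x a)%g.

Definition step_val x (s : step A) : gT := if s.1 then x s.2 else (x s.2)^-1%g.

Lemma potential_step T x g s : potential T x g -> s.2 \in T ->
  g (step_tgt H s) = (g (step_src H s) * step_val x s)%g.
Proof.
move=> pot /pot e; rewrite /step_val /step_src /step_tgt.
by case: s.1; rewrite e ?mulgK.
Qed.

Lemma potential_walk T x g u v p : potential T x g ->
  is_walk u v p -> all (fun s => s.2 \in T) p ->
  g v = (g u * \prod_(s <- p) step_val x s)%g.
Proof.
move=> pot; elim: p u => [|s p IH] u /=.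
  by move/eqP->; rewrite big_nil mulg1.
case/andP=> /eqP <- sp /andP[sT pT].
by rewrite (IH _ sp pT) big_cons mulgA (potential_step pot sT).
Qed.

(** By induction on the number of arcs: a potential for the forest without [a] is
    corrected by a left translation on the component of the head of [a], which
    does not contain the tail. *)
Lemma acyclic_potential T x : acyclic H T -> exists g, potential T x g.
Proof.
move En : #|T| => n; elim: n T En => [|n IH] T Tn acT.
  by exists (fun=> 1%g) => a; rewrite (cards0_eq Tn) inE.
have [a aT] : exists a, a \in T by apply/card_gt0P; rewrite Tn.
have [g' pot] : exists g, potential (T :\ a) x g.
  apply: IH; last by apply: acyclic_sub acT; apply: finset.subsetDl.
  by have := cardsD1 a T; rewrite aT Tn => -[].
have := acyclic_bridge acT aT; set C := connect _ _ => Ca.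
pose r := (g' (arc_src H a) * x a * (g' (arc_tgt H a))^-1)%g.
exists (fun v => if C v then r * g' v else g' v)%g => b bT.
have [->|ba] := eqVneq b a.
  by rewrite (negbTE Ca) /C connect0 /r mulgKV.
have bT' : b \in T :\ a by rewrite !inE ba.
have -> : C (arc_tgt H b) = C (arc_src H b).
  apply/idP/idP => /connect_trans; apply; apply: connect1; apply/existsP.
    by exists (false, b); rewrite /= bT' !eqxx.
  by exists (true, b); rewrite /= bT' !eqxx.
by case: ifP; rewrite (pot b bT') ?mulgA.
Qed.

(** A forest has fewer arcs than vertices, in the multiplicative form used below:
    all values on [T] and at [r] are attained by potentials. *)
Lemma acyclic_card T (r : vertex H) : acyclic H T ->
  (#|gT| ^ #|T| * #|gT| <= #|gT| ^ #|vertex H|)%N.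
Proof.
move=> acT.
pose F (g : {ffun vertex H -> gT}) :=
  ([ffun a => if a \in T then (g (arc_src H a))^-1 * g (arc_tgt H a) else 1]%g, g r).
pose Y := pffun_on (1 : gT)%g (mem T) (mem predT).
have -> : (#|gT| ^ #|T| * #|gT|)%N = #|[predX Y & (predT : pred gT)]|.
  by rewrite cardX card_pffun_on.
rewrite -card_ffun; apply: leq_trans (leq_image_card F predT).
apply: subset_leq_card; apply/fintype.subsetP => -[y t].
rewrite !inE andbT => /pffun_onP[suppy _].
have [g pot] := @acyclic_potential T y acT.
apply/fintype.imageP; exists [ffun v => t * (g r)^-1 * g v]%g => //.
congr (_, _); last by rewrite ffunE mulgKV.
apply/ffunP => a; rewrite !ffunE; case: ifPn => aT.
  by rewrite (pot a aT) [(_ * (g _ * _))%g]mulgA mulKg.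
by apply/eqP; apply: contraNT aT => ya; apply: (fintype.subsetP suppy).
Qed.

Lemma prod_rot_eq1 (I : Type) (F : I -> gT) n (c : seq I) :
  (\prod_(i <- rot n c) F i = 1 <-> \prod_(i <- c) F i = 1)%g.
Proof.
rewrite -[in X in _ <-> X](cat_take_drop n c) /rot !big_cat /=.
have comm (y z : gT) : (y * z = 1 -> z * y = 1)%g.
  by move/eqP; rewrite -eq_invg_mul => /eqP <-; rewrite mulVg.
by split; exact: comm.
Qed.

(** Turned so as to start with [a], the cycle is [a] followed by a walk in [T],
    along which the potential is known. *)
Lemma cycle_closes T x g a c :
  fundamental_cycle H T a c -> potential T x g ->
  (\prod_(s <- c) step_val x s = 1)%g ->
  g (arc_tgt H a) = (g (arc_src H a) * x a)%g.
Proof.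
case=> aT /and4P[_ cyc _ uc] [p [_ pT cp]] pot.
have /mapP[s sc sa] : a \in map snd c.
  by have : a \in arcs_of c; [rewrite cp !inE eqxx | rewrite inE].
have [n c' rc] := rot_to sc.
move/(prod_rot_eq1 _ n); rewrite rc big_cons => /eqP.
rewrite -eq_invg_mul => /eqP prod.
have walk : is_walk (step_tgt H s) (step_src H s) c'.
  by rewrite -walk_cycle -rc rot_cycle.
have c'T : all (fun s => s.2 \in T) c'.
  apply/allP => t tc'.
  have : t.2 \in arcs_of c by rewrite inE map_f // -(mem_rot n) rc inE tc' orbT.
  rewrite cp !inE => /orP[/eqP ta|]; last first.
    by move=> tp; apply: (fintype.subsetP pT); rewrite inE.
  move: uc; rewrite -(rot_uniq n) -map_rot rc /= -sa -ta map_f //.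
have := potential_walk pot walk c'T; rewrite -prod.
rewrite /step_val /step_src /step_tgt -sa.
by case: s.1 => ->; rewrite ?invgK ?mulgKV ?mulgK.
Qed.

Lemma cycle_prod g c : is_cycle H c ->
  (\prod_(s <- c) step_val (fun a => (g (arc_src H a))^-1 * g (arc_tgt H a)) s = 1)%g.
Proof.
case: c => [|s c] /and4P[_ + _ _] //; rewrite walk_cycle big_cons => walk.
set x := fun a => _; have pot : potential [set: A]%SET x g.
  by move=> a _; rewrite mulKVg.
have := potential_walk pot walk; rewrite (potential_step (s := s) pot) ?inE //.
rewrite -mulgA => /(_ _)/esym e; apply: (mulgI (g (step_src H s))).
by rewrite mulg1 e //; apply/allP => ? _; rewrite inE.
Qed.

End Potentials.

Lemma prod_eq_steps (k m : nat) (sigma : 'I_k -> 'S_m) (eps : 'I_k -> 'I_m -> int)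
    (gT : finGroupType) (x : 'I_m -> gT) (i : 'I_k) :
  (forall j, eps i j \in [:: -1; 0; 1]) ->
  (\prod_(j < m) expgz (x (sigma i j)) (eps i (sigma i j)) =
   \prod_(s <- eq_steps sigma eps i) step_val x s)%g.
Proof.
move=> eps_val; rewrite /eq_steps big_map big_filter enumT [index_enum _]unlock /=.
rewrite [RHS]big_mkcond; apply: eq_bigr => j _.
have := eps_val (sigma i j); rewrite !inE.
by case/or3P=> /eqP ->; rewrite /= ?expg1.
Qed.

(** * Removal for potential differences in a group *)

Lemma sum_card_translates (gT : finGroupType) (P : gT -> gT -> bool) :
  (\sum_b #|[pred x | P x (x * b)%g]| = #|[pred z : gT * gT | P z.1 z.2]|)%N.
Proof.
have -> : #|[pred z : gT * gT | P z.1 z.2]| = (\sum_x \sum_y (P x y : nat))%N.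
  rewrite pair_bigA -sum1_card big_mkcond; apply: eq_bigr => z _.
  by rewrite unfold_in /=; case: (P _ _).
under [RHS]eq_bigr => x _ do rewrite (reindex_inj (mulgI x)).
rewrite exchange_big /=; apply: eq_bigr => b _.
rewrite -sum1_card big_mkcond; apply: eq_bigr => x _.
by rewrite unfold_in /=; case: (P _ _).
Qed.

Section Popular.
Variables (gT : finGroupType) (P : gT -> gT -> bool) (L : nat).

(** The number of pairs in [P] labelled by [b] in the Cayley graph. *)
Definition fiber (b : gT) : nat := #|[pred x | P x (x * b)%g]|.

Definition popular : {set gT} := [set b | (#|gT| < L * fiber b)%N]%SET.

Lemma card_popular : (#|popular| * #|gT| <= L * #|[pred z : gT * gT | P z.1 z.2]|)%N.
Proof.
rewrite -sum_card_translates big_distrr /= -sum_nat_const big_mkcond /=.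
by apply: leq_sum => b _; rewrite inE; case: ifP => // /ltnW.
Qed.

End Popular.

Section GroupRemoval.
Variables (A : finType) (H : digraph A).
Local Notation V := (vertex H).

Definition joins (a : A) : rel V := fun u v => (arc_src H a == u) && (arc_tgt H a == v).

(** The removal lemma wants at most one relation for each pair of vertices, so
    parallel and opposite arcs are merged and the vertices are ordered.  Loops
    disappear: their value is 1 in every solution. *)
Definition ordered_adj : rel V := fun u v =>
  (enum_rank u < enum_rank v)%N && [exists a, joins a u v || joins a v u].

Lemma ordered_adj_asym u v : ordered_adj u v -> ~~ ordered_adj v u.
Proof. by case/andP=> uv _; rewrite negb_and -leqNgt ltnW. Qed.

Lemma ordered_adj_arc a : [|| arc_src H a == arc_tgt H a,
  ordered_adj (arc_src H a) (arc_tgt H a) | ordered_adj (arc_tgt H a) (arc_src H a)].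
Proof.
rewrite /ordered_adj; case: (ltngtP (enum_rank (arc_src H a)) (enum_rank (arc_tgt H a))) => /=.
- move=> _; apply/orP; right; apply/orP; left.
  by apply/existsP; exists a; rewrite /joins !eqxx.
- by move=> _; apply/orP; right; apply/existsP; exists a; rewrite /joins !eqxx orbT.
by move/val_inj/enum_rank_inj->; rewrite eqxx.
Qed.

Section FixedGroup.
Variables (gT : finGroupType) (S : A -> {set gT}).

Definition consistent_in (x : {ffun A -> gT}) : Prop :=
  (exists g : V -> gT, potential [set: A]%SET x g) /\ (forall a, x a \in S a).

Definition labels (u v : V) : {set gT} :=
  [set b | [forall a, (joins a u v ==> (b \in S a)) &&
                      (joins a v u ==> (b^-1 \in S a)%g)]]%SET.

Definition cayley (u v : V) : rel gT := fun x y => (x^-1 * y)%g \in labels u v.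

Definition potential_diff (g : {ffun V -> gT}) : {ffun A -> gT} :=
  [ffun a => (g (arc_src H a))^-1 * g (arc_tgt H a)]%g.

Lemma potential_diffP g : potential [set: A]%SET (potential_diff g) g.
Proof. by move=> a _; rewrite ffunE mulKVg. Qed.

(** The solution [x0] is there for the loops: it shows that 1 is admissible for
    them. *)
Lemma hom_consistent x0 g : consistent_in x0 ->
  is_hom ordered_adj cayley g -> consistent_in (potential_diff g).
Proof.
move=> [[g0 pot0] x0S] /forallP hom; split.
  by exists g; exact: potential_diffP.
have {}hom u v : ordered_adj u v -> cayley u v (g u) (g v).
  by move=> uv; move/forallP/(_ v)/implyP: (hom u); apply.
move=> a; rewrite ffunE.
have /or3P[/eqP loop|/hom|/hom] := ordered_adj_arc a.
- rewrite -loop mulVg; suff <- : x0 a = 1%g by [].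
  have := pot0 a (finset.in_setT a); rewrite -loop => /(congr1 (mulg (g0 (arc_src H a))^-1)).
  by rewrite mulKg mulVg.
- rewrite /cayley inE => /forallP/(_ a)/andP[/implyP + _]; apply.
  by rewrite /joins !eqxx.
rewrite /cayley inE => /forallP/(_ a)/andP[_ /implyP].
by rewrite invMg invgK; apply; rewrite /joins !eqxx.
Qed.

Lemma potential_diff_inj (T : {set A}) (r : V) :
  (forall u v : V, exists p, is_walk u v p /\ arcs_of p \subset T) ->
  injective (fun g : {ffun V -> gT} => (potential_diff g, g r)).
Proof.
move=> conn g g' [e er]; apply/ffunP => v; have [p [walk _]] := conn r v.
have pT : all (fun s => s.2 \in [set: A]%SET) p by apply/allP => s _; rewrite inE.
rewrite (potential_walk (@potential_diffP g) walk pT).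
by rewrite (potential_walk (@potential_diffP g') walk pT) e er.
Qed.

Section Discard.
Variables (E' : V -> V -> rel gT) (L : nat).
Hypothesis L_big : (#|{: V * V}| < L)%N.
Hypothesis no_hom : forall g, ~~ is_hom ordered_adj E' g.

Definition lost (u v : V) : {set gT} :=
  popular (fun x y => cayley u v x y && ~~ E' u v x y) L.

Definition discarded (a : A) : {set gT} :=
  if ordered_adj (arc_src H a) (arc_tgt H a) then lost (arc_src H a) (arc_tgt H a)
  else if ordered_adj (arc_tgt H a) (arc_src H a)
  then ((lost (arc_tgt H a) (arc_src H a))^-1)%g
  else finset.set0.

(** Each left translate of [g] fails to respect [E'] at some adjacent pair of
    vertices, but each pair is responsible for at most [#|gT| / L] translates,
    and there are fewer than [L] pairs. *)
Lemma discard_consistent (g : V -> gT) (x : A -> gT) :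
  potential [set: A]%SET x g -> ~ (forall a, x a \in S a :\: discarded a)%SET.
Proof.
move=> pot xS; pose b u v := ((g u)^-1 * g v)%g.
have xb a : x a = b (arc_src H a) (arc_tgt H a).
  by rewrite /b (pot a) ?inE // mulKg.
have b_label u v : b u v \in labels u v.
  rewrite inE; apply/forallP => a; apply/andP; split; apply/implyP => /andP[/eqP <- /eqP <-].
    by rewrite -xb; have /setDP[] := xS a.
  by rewrite /b invMg invgK -[(_ * _)%g]/(b _ _) -xb; have /setDP[] := xS a.
have b_kept u v : ordered_adj u v -> b u v \notin lost u v.
  move=> uv; case/andP: (uv) => _ /existsP[a /orP[] /andP[/eqP e1 /eqP e2]].
    by have := xS a; rewrite /discarded e1 e2 uv xb e1 e2 !inE => /andP[].
  have := xS a; rewrite /discarded e1 e2 (negbTE (ordered_adj_asym uv)) uv.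
  by rewrite xb e1 e2 inE mem_invg /b invMg invgK => /andP[].
pose W u v := #|[pred t : gT | ordered_adj u v && ~~ E' u v (t * g u) (t * g v)]|%g.
have Wsmall u v : (L * W u v <= #|gT|)%N.
  have [uv|/negbTE nuv] := boolP (ordered_adj u v); last first.
    by rewrite /W nuv (eq_card (B := pred0)) ?card0 ?muln0.
  have := b_kept u v uv; rewrite inE -leqNgt; apply: leq_trans.
  rewrite leq_mul2l; apply/orP; right.
  rewrite /W /fiber -(fintype.card_image (@mulIg _ (g u))).
  apply: subset_leq_card; apply/fintype.subsetP => _ /fintype.imageP[t + ->].
  rewrite !inE uv /= => nE'.
  have e : (t * g u * b u v)%g = (t * g v)%g by rewrite /b -mulgA mulKVg.
  by rewrite e nE' andbT /cayley -e mulKg b_label.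
have cover : (#|gT| <= \sum_(q : V * V) W q.1 q.2)%N.
  rewrite -sum1_card; pose w t (q : V * V) : nat :=
    ordered_adj q.1 q.2 && ~~ E' q.1 q.2 (t * g q.1)%g (t * g q.2)%g.
  apply: (@leq_trans (\sum_(t : gT) \sum_(q : V * V) w t q)).
    apply: leq_sum => t _; have := no_hom [ffun v => t * g v]%g.
    rewrite negb_forall => /existsP[u]; rewrite negb_forall => /existsP[v].
    rewrite negb_imply !ffunE => uv.
    by rewrite (bigD1 (u, v)) //= /w uv.
  rewrite exchange_big /=; apply: leq_sum => q _.
  rewrite /W -sum1_card [leqRHS]big_mkcond /=; apply: leq_sum => t _.
  by rewrite /w unfold_in /=; case: ifP.
have gT0 : (0 < #|gT|)%N by apply/card_gt0P; exists 1%g.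
have := leq_mul (leqnn L) cover; rewrite big_distrr /= leqNgt => /negP; apply.
apply: (@leq_ltn_trans (\sum_(q : V * V) #|gT|)); first by apply: leq_sum.
by rewrite sum_nat_const ltn_pmul2r.
Qed.

Lemma card_discarded (R : realFieldType) (theta : R) a :
  (forall u v, #|[pred z : gT * gT | cayley u v z.1 z.2 && ~~ E' u v z.1 z.2]|%:R
     <= theta * #|gT|%:R ^+ 2) -> 0 <= theta ->
  #|discarded a|%:R <= L%:R * theta * #|gT|%:R.
Proof.
move=> few theta0; have gT0 : 0 < #|gT|%:R :> R.
  by rewrite ltr0n; apply/card_gt0P; exists 1%g.
have card_lost u v : #|lost u v|%:R <= L%:R * theta * #|gT|%:R.
  rewrite -(ler_pM2r gT0) -natrM.
  have := card_popular (fun x y => cayley u v x y && ~~ E' u v x y) L.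
  rewrite -(ler_nat R) => /le_trans; apply; rewrite natrM -!mulrA -expr2 ler_wpM2l //.
rewrite /discarded; case: ifP => _; first exact: card_lost.
case: ifP => _; first by rewrite card_invg.
by rewrite cards0 !mulr_ge0 // ltW.
Qed.

End Discard.
End FixedGroup.

(** Without solutions there is nothing to remove; this case is separate because
    an inadmissible loop is not seen by [cayley]. *)
Theorem consistent_removal (R : archiRealFieldType) (T : {set A}) (eps : R) :
    spanning_tree H T -> forall r : V, 0 < eps ->
  exists delta : R, 0 < delta /\
  forall (gT : finGroupType) (S : A -> {set gT}) (sols : {set {ffun A -> gT}}),
    (forall x, x \in sols <-> consistent_in S x) ->
    #|sols|%:R < delta * #|gT|%:R ^+ #|T| ->
  exists S' : A -> {set gT},
    [/\ forall a, S' a \subset S a,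
        forall a, #|S a :\: S' a|%SET%:R <= eps * #|gT|%:R &
        forall x, ~ consistent_in S' x].
Proof.
move=> [conn acT] r eps0; pose L := #|{: V * V}|.+1.
have L0 : 0 < L%:R :> R by rewrite ltr0n.
have [delta [delta0 rem]] := graph_removal ordered_adj_asym (divr_gt0 eps0 L0).
exists delta; split=> // gT S sols solsP few.
have gT0 : 0 < #|gT|%:R :> R by rewrite ltr0n; apply/card_gt0P; exists 1%g.
have [sols0|[x0 /solsP x0P]] := set_0Vmem sols.
  exists S; split=> [//|a|x /solsP]; last by rewrite sols0 inE.
  by rewrite finset.setDv cards0 mulr_ge0 // ltW.
have homs : (#|is_hom ordered_adj (cayley S)| <= #|sols| * #|gT|)%N.
  rewrite -(fintype.card_image (potential_diff_inj (r := r) conn)).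
  have -> : (#|sols| * #|gT|)%N = #|[predX sols & (predT : pred gT)]| by rewrite cardX.
  apply: subset_leq_card; apply/fintype.subsetP => _ /fintype.imageP[g hom ->].
  by rewrite inE /= andbT; apply/solsP; apply: hom_consistent hom; exact: x0P.
have [|E' [E'E lostE no]] := rem gT (cayley S).
  apply: (@le_lt_trans _ _ (#|sols|%:R * #|gT|%:R)); first by rewrite -natrM ler_nat.
  apply: (@lt_le_trans _ _ (delta * #|gT|%:R ^+ #|T| * #|gT|%:R)).
    by rewrite ltr_pM2r.
  rewrite -mulrA ler_wpM2l ?(ltW delta0) // -!natrX -natrM ler_nat.
  exact: acyclic_card.
exists (fun a => S a :\: discarded S E' L a)%SET; split=> [a|a|x [[g pot] xS]].
- exact: finset.subsetDl.
- rewrite finset.setDDr finset.setDv finset.set0U.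
  have := card_discarded L a lostE (ltW (divr_gt0 eps0 L0)).
  rewrite mulrCA divff ?gt_eqF // mulr1; apply: le_trans.
  by rewrite ler_nat subset_leq_card // finset.subsetIr.
exact: discard_consistent no _ _ pot xS.
Qed.

End GroupRemoval.

(** * Systems of equations *)

Section SystemPotentials.
Variables (k m : nat) (sigma : 'I_k -> 'S_m) (eps : 'I_k -> 'I_m -> int).
Hypothesis eps_val : forall i j, eps i j \in [:: -1; 0; 1].
Variables (H : digraph 'I_m) (T : {set 'I_m}) (f : 'I_k -> 'I_m).
Hypothesis treeT : spanning_tree H T.
Hypothesis f_cotree : [set f i | i : 'I_k]%SET = ~: T.
Hypothesis cycles : forall i, fundamental_cycle H T (f i) (eq_steps sigma eps i).
Variable gT : finGroupType.

Lemma solution_potential (x : {ffun 'I_m -> gT}) :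
  is_solution sigma eps x <->
  exists g : vertex H -> gT, potential [set: 'I_m]%SET x g.
Proof.
split=> [/forallP sol|[g pot]].
  have [g pot] := acyclic_potential x treeT.2; exists g => a _.
  have [aT|aT] := boolP (a \in T); first exact: pot.
  have : a \in ~: T by rewrite inE.
  rewrite -f_cotree => /imsetP[i _ ->].
  apply: (cycle_closes (cycles i) pot).
  by rewrite -prod_eq_steps; [apply/eqP/sol | exact: eps_val].
apply/forallP => i; rewrite prod_eq_steps; last exact: eps_val.
have [_ cyc _] := cycles i; rewrite -[X in _ == X](cycle_prod g cyc).
apply/eqP; apply: eq_bigr => s _; rewrite /step_val.
have -> : x s.2 = ((g (arc_src H s.2))^-1 * g (arc_tgt H s.2))%g.
  by rewrite (pot s.2) ?inE // mulKg.
by [].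
Qed.

End SystemPotentials.

Import numFieldNormedType.Exports.
Local Open Scope classical_set_scope.

(** The infimum of the bounds that are good for [d] need not be good itself; the
    summand [d] makes up for this, and vanishes in the limit. *)
Lemma modulus_exists (R : realType) (good : R -> R -> Prop) :
    (forall d d' e e', d' <= d -> e <= e' -> good d e -> good d' e') ->
    (forall d, good d 1) ->
    (forall e, 0 < e -> exists d, 0 < d /\ good d e) ->
  exists delta' : R -> R, delta' x @[x --> 0^'+] --> (0 : R) /\
    forall d, 0 < d -> good d (delta' d).
Proof.
move=> mono good1 small.
pose S d := [set e | 0 < e /\ good d e].
have lbS d : lbound (S d) 0 by move=> e [/ltW].
have infS d : has_inf (S d).
  by split; [exists 1; split; [exact: ltr01 | exact: good1] | exists 0].
exists (fun d => inf (S d) + d); split=> [|d d0]; last first.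
  have [e [_ ge] elt] := inf_adherent d0 (infS d).
  exact: mono (lexx _) (ltW elt) ge.
apply/cvgrPdist_le => e e0.
have e20 : 0 < e / 2 by rewrite divr_gt0.
have [d0 [d0_gt0 gd0]] := small _ e20.
near=> x.
have x0 : 0 < x by near: x; exact: nbhs_right_gt.
have xd0 : x <= d0 by near: x; exact: nbhs_right_le.
have xe : x <= e / 2 by near: x; exact: nbhs_right_le.
have inf0 : 0 <= inf (S x) by apply: lb_le_inf; [exact: (infS x).1 | exact: lbS].
have infe : inf (S x) <= e / 2.
  apply: ge_inf; first exact: (infS x).2.
  by split=> //; apply: mono xd0 (lexx _) gd0.
rewrite sub0r normrN ger0_norm ?addr_ge0 // ?(ltW x0) //; lra.
Unshelve. all: by end_near. Qed.

Theorem theorem4 (R : realType) (k m : nat)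
    (sigma : 'I_k -> 'S_m) (eps : 'I_k -> 'I_m -> int)
    (k_ge1 : (1 <= k)%N) (m_ge2 : (2 <= m)%N)
    (eps_val : forall (i : 'I_k) (j : 'I_m), eps i j \in [:: -1; 0; 1])
    (repr : strongly_graph_representable sigma eps) :
  exists delta' : R -> R,
    delta' x @[x --> 0^'+] --> (0 : R) /\
    forall delta : R, 0 < delta ->
    forall (gT : finGroupType) (A : 'I_m -> {set gT}),
      #|solutions_in sigma eps A|%:R < delta * (#|gT|%:R) ^+ (m - k) ->
      exists A' : 'I_m -> {set gT},
        [/\ forall i, A' i \subset A i,
            forall i, #|A i :\: A' i|%:R <= delta' delta * #|gT|%:R &
            solutions_in sigma eps A' = finset.set0].
Proof.
have [H [T [f [treeT f_inj f_cotree cycles]]]] := repr.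
pose j0 := Ordinal (ltnW m_ge2).
have solP (gT : finGroupType) (A : 'I_m -> {set gT}) x :
    x \in solutions_in sigma eps A <-> consistent_in H A x.
  have sp := solution_potential eps_val treeT f_cotree cycles x.
  rewrite inE; split=> [/andP[/sp pot /forallP xA] //|[/sp -> /= xA]].
  exact/forallP.
have cardT : #|T| = (m - k)%N.
  have := cardsC T; rewrite -f_cotree (finset.card_imset _ f_inj) !card_ord.
  by move=> e; rewrite -[X in _ = (X - _)%N]e addnK.
pose removable (d e : R) := forall (gT : finGroupType) (A : 'I_m -> {set gT}),
  #|solutions_in sigma eps A|%:R < d * (#|gT|%:R) ^+ (m - k) ->
  exists A' : 'I_m -> {set gT},
    [/\ forall i, A' i \subset A i,
        forall i, #|A i :\: A' i|%:R <= e * #|gT|%:R &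
        solutions_in sigma eps A' = finset.set0].
apply: (@modulus_exists R removable) => [d d' e e' dd' ee' rem gT A few|d gT A _|e e0].
- have [|A' [sub close none]] := rem gT A.
    by apply: (lt_le_trans few); rewrite ler_wpM2r ?exprn_ge0.
  exists A'; split=> // i; apply: (le_trans (close i)).
  by rewrite ler_wpM2r.
- exists (fun=> finset.set0); split=> [i|i|]; first exact: finset.sub0set.
    by rewrite mul1r ler_nat max_card.
  apply/setP => x; rewrite !inE; apply/negbTE; rewrite negb_and orbC.
  by apply/orP; left; apply/negP => /forallP/(_ j0); rewrite inE.
have [d [d0 rem]] := consistent_removal treeT (arc_src H j0) e0.
exists d; split=> // gT A few.
have [|A' [sub close none]] := rem gT A _ (solP gT A); first by rewrite cardT.
exists A'; split=> //; apply/setP => x; rewrite [in RHS]inE.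
by apply/negP => /solP /none.
Qed.
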